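(* Let $\mathcal{L}$ be a classical propositional language with set of propositional variables $U = v(\mathcal{L})$, let $\mathcal{X}$ be a definable set of $\mathcal{L}$-models, and let $\{\mathcal{A}_m : m \in M\}$ be a (possibly infinite) set of factorizations of $\mathcal{X}$ over $U$. Let $\mathcal{A}$ be the (coarsest) common refinement of all the $\mathcal{A}_m$, $m\in M$. Then $\mathcal{A}$ is also a factorization of $\mathcal{X}$ over $U$.
   Context: The language $\mathcal{L}$ may have infinitely many propositional variables; formulas are finite. An $\mathcal{L}$-model is a function $\sigma : U \to \{0,1\}$, so the set of all models is $\mathcal{Y} = \prod\{Y_k : k\in U\}$ with $Y_k=\{0,1\}$ for every $k$. A set $\mathcal{X}\subseteq\mathcal{Y}$ is definable if there is a theory $T$ (a set of formulas of $\mathcal{L}$) such that $\mathcal{X} = M(T)$, the set of models of $T$. For $U'\subseteq U$, $\sigma\lceil U'$ denotes the restriction of $\sigma$ to $U'$, and $\mathcal{X}\lceil U' := \{\sigma\lceil U' : \sigma\in\mathcal{X}\}$. A partition $\{A_i : i\in I\}$ of $U$ (into nonempty blocks) is a factorization of $\mathcal{X}$ over $U$ iff $\mathcal{X} = \{\sigma\in\mathcal{Y} : \forall i\in I\ (\sigma\lceil A_i \in \mathcal{X}\lceil A_i)\}$. A partition $\mathcal{A}$ of $U$ is a refinement of a partition $\mathcal{B}$ of $U$ iff every block of $\mathcal{A}$ is contained in some block of $\mathcal{B}$. The coarsest common refinement of $\{\mathcal{A}_m : m\in M\}$ is the partition of $U$ whose blocks are the equivalence classes of the relation: $k\sim k'$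 iff for every $m\in M$, $k$ and $k'$ lie in the same block of $\mathcal{A}_m$. *)

(* Defs.v *)
From mathcomp Require Import all_boot.
From mathcomp Require Import boolp classical_sets functions.

Set Implicit Arguments.
Unset Strict Implicit.
Unset Printing Implicit Defensive.

Local Open Scope classical_set_scope.

(* There are no nullary connectives. Over a nonempty set of variables they are
   definable, so the definable sets of models are the usual ones. Over an empty
   set of variables, a constant for falsity would make the empty set of models
   definable, and the partition with no blocks does not factorize it. *)
Inductive formula (U : Type) : Type :=
| Var of U
| Neg of formula U
| And of formula U & formula U
| Or of formula U & formula U
| Imp of formula U & formula U
| Iff of formula U & formula U.

Definition model (U : Type) : Type := U -> bool.

Fixpoint eval (U : Type) (s : model U) (p : formula U) : bool :=
  match p with
  | Var k => s k
  | Neg q => ~~ eval s q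
  | And q r => eval s q && eval s r
  | Or q r => eval s q || eval s r
  | Imp q r => eval s q ==> eval s r
  | Iff q r => eval s q == eval s r
  end.

Definition models (U : Type) (T : set (formula U)) : set (model U) :=
  [set s | forall p, T p -> eval s p].

Definition definable (U : Type) (X : set (model U)) : Prop :=
  exists T : set (formula U), X = models T.

Definition restr (U : Type) (A : set U) (s : model U) : A -> bool := sigL A s.
Arguments restr {U} A s _.

Definition restr_set (U : Type) (X : set (model U)) (A : set U) :
    set (A -> bool) :=
  [set restr A s | s in X].
Arguments restr_set {U} X A _.

(* The partition, a set of blocks, is indexed by itself through [id]. *)
Definition factorization (U : Type) (X : set (model U)) (P : set (set U)) :
    Prop :=
  partition P id [set: U] /\
  X = [set s | forall A, P A -> restr_set X A (restr A s)].

Definition same_blocks (U M : Type) (P : M -> set (set U)) (k k' : U) : Prop :=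
  forall m, exists2 A, P m A & A k /\ A k'.

Definition common_refinement (U M : Type) (P : M -> set (set U)) :
    set (set U) :=
  range (fun k => [set k' | same_blocks P k k']).

(* Main.v *)
Require Import Defs.
From mathcomp Require Import all_boot.
From mathcomp Require Import boolp classical_sets functions.

(** Say that [s] extends from a set [D] of variables when some member of [X]
    agrees with [s] on [D].  A partition factorizes [X] exactly when every [s]
    that extends from each block lies in [X].  The proof combines two facts.

    Compactness: [X] is the set of models of a theory, and each formula mentions
    finitely many variables, so [s] lies in [X] as soon as it extends from every
    finite set of variables ([definable_finite_extends]).

    Localization: if [P] factorizes [X], then [s] extends from any set [D] as
    soon as it extends from the trace on [D] of each block of [P]
    ([factorization_extends]), because the members of [X] chosen for the
    different blocks can be glued into one member of [X].

    Suppose now that [s] extends from each block of the common refinement, and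
    let [D] be finite.  If two elements of [D] are separated by some partition
    of the family, every block of that partition meets [D] in a strictly smaller
    set; localization and induction on the size of [D] show that [s] extends
    from [D].  Otherwise [D] lies in a single block of the common refinement,
    from which [s] extends by assumption.  So infinitely many partitions are
    handled without forming any of their finite refinements. *)

Set Implicit Arguments.
Unset Strict Implicit.
Unset Printing Implicit Defensive.

Local Open Scope classical_set_scope.

Section Partitions.
Variable U : Type.
Implicit Types (P : set (set U)) (A : set U).

(** Written so that [same_blocks] unfolds to membership in the block of every
    partition of the family. *)
Definition block_of P (k : U) : set U :=
  [set k' | exists2 A, P A & A k /\ A k'].

Lemma block_ofE P A k :
  partition P id [set: U] -> P A -> A k -> block_of P k = A.
Proof.
move=> [_ tP _] PA Ak; apply/seteqP; split=> [k' [B PB [Bk Bk']]|k' Ak'].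
  by rewrite (tP A B PA PB _) //; exists k.
by exists A.
Qed.

Lemma mem_block_of P k : partition P id [set: U] -> block_of P k k.
Proof.
move=> [cP _ _]; have : [set: U] k by [].
by rewrite -cP => -[A PA Ak]; exists A.
Qed.

Lemma eq_block_of P k k' :
  partition P id [set: U] -> block_of P k k' -> block_of P k' = block_of P k.
Proof.
by move=> pP [A PA [Ak Ak']]; rewrite (block_ofE pP PA Ak) (block_ofE pP PA Ak').
Qed.

Lemma partition_common_refinement (M : Type) (P : M -> set (set U)) :
  (forall m, partition (P m) id [set: U]) ->
  partition (common_refinement P) id [set: U].
Proof.
move=> pP; split.
- apply/seteqP; split=> // k _; exists [set k' | same_blocks P k k'].
    by exists k.
  by move=> m; apply: mem_block_of.
- move=> _ _ [i _ <-] [j _ <-] [k [ik jk]].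
  have ij m : block_of (P m) i = block_of (P m) j.
    by rewrite -(eq_block_of (pP m) (ik m)) -(eq_block_of (pP m) (jk m)).
  rewrite -[LHS]/[set k' | forall m, block_of (P m) i k'].
  by under eq_set do under eq_forall do rewrite ij.
- by move=> _ [k _ <-]; exists k => m; apply: mem_block_of.
Qed.

End Partitions.

Section Extension.
Variable U : Type.
Implicit Types (X : set (model U)) (s : model U) (D A : set U).

Definition extends X s D : Prop := exists2 t, X t & {in D, t =1 s}.

Lemma extendsP X s D : restr_set X D (restr D s) <-> extends X s D.
Proof.
by split=> [] [t Xt ts]; exists t => //; apply/eq_sigLP.
Qed.

Lemma extendsS X s D D' : D `<=` D' -> extends X s D' -> extends X s D.
Proof.
by move=> DD' [t Xt ts]; exists t => // k /set_mem /DD' /mem_set; apply: ts.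
Qed.

(** Gluing: on each block use a member of [X] that agrees with [s] on the trace
    of that block on [D]. *)
Lemma factorization_extends X (P : set (set U)) s D :
  factorization X P -> (forall k, extends X s (D `&` block_of P k)) ->
  extends X s D.
Proof.
move=> [pP XE] ext.
(* The set chosen from depends on [k] only through its block, so the choice is
   constant on blocks; the default value [s] is never taken. *)
pose c k := xget s [set t | X t /\ {in D `&` block_of P k, t =1 s}].
have cP k : X (c k) /\ {in D `&` block_of P k, c k =1 s}.
  case: (ext k) => t Xt ts; rewrite /c.
  by case: xgetP => [_ _ //|/(_ t)]; case.
exists (fun k => c k k).
  rewrite XE => A PA; apply/extendsP.
  case: (pP) => _ _ /(_ A PA) [k Ak].
  exists (c k); first by case: (cP k).
  move=> k' /set_mem Ak'; rewrite /c.
  by rewrite (block_ofE pP PA Ak) (block_ofE pP PA Ak').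
move=> k /set_mem Dk; case: (cP k) => _; apply.
by apply: mem_set; split=> //; apply: mem_block_of.
Qed.

End Extension.

(** The variable [k0] only serves the empty sequence, where it provides a block
    and with it a member of [X]. *)
Lemma finite_extends (U : eqType) (X : set (model U)) (M : Type)
    (P : M -> set (set U)) (s : model U) (k0 : U) (l : seq U) :
  (forall m, factorization X (P m)) ->
  (forall k, extends X s [set k' | same_blocks P k k']) ->
  extends X s [set` l].
Proof.
move=> fP ext; have [n] := ubnP (size l); elim: n l => // n IHn l ltn.
have [[m [i [j [il jl ij]]]]|nsep] :=
    pselect (exists m i j, [/\ i \in l, j \in l & ~ block_of (P m) i j]).
  apply: (factorization_extends (fP m)) => k.
  pose l' := [seq k' <- l | `[< block_of (P m) k k' >]].
  apply: (@extendsS _ _ _ _ [set` l']).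
    by move=> k' [/= k'l kk']; rewrite /= mem_filter k'l andbT; apply/asboolP.
  apply: IHn; apply: leq_trans (_ : size l <= n)%N => //.
  rewrite size_filter ltn_neqAle count_size andbT -all_count.
  (* The block of [k] cannot contain both [i] and [j]. *)
  apply/allP => kl; apply: ij; have [pP _] := fP m.
  have /asboolP ki := kl _ il; have /asboolP kj := kl _ jl.
  by rewrite (eq_block_of pP ki).
case: l ltn nsep => [|a l] _ nsep.
  by apply: extendsS (ext k0) => k /=.
apply: extendsS (ext a) => k /= kl m; apply: contrapT => ak.
by apply: nsep; exists m, a, k; rewrite mem_head.
Qed.

Fixpoint vars (U : Type) (p : formula U) : seq U :=
  match p with
  | Var k => [:: k]
  | Neg q => vars q
  | And q r | Or q r | Imp q r | Iff q r => vars q ++ vars r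
  end.

Lemma eq_in_eval (U : eqType) (p : formula U) (s t : model U) :
  {in vars p, s =1 t} -> eval s p = eval t p.
Proof.
have sub (q r : formula U) : {in vars q ++ vars r, s =1 t} ->
    {in vars q, s =1 t} /\ {in vars r, s =1 t}.
  by move=> st; split=> k kq; apply: st; rewrite mem_cat kq ?orbT.
elim: p => /= [k|q IHq|q IHq r IHr|q IHq r IHr|q IHq r IHr|q IHq r IHr] st;
  first by apply: st; rewrite mem_head.
  by rewrite IHq.
all: by have [sq sr] := sub _ _ st; rewrite IHq // IHr.
Qed.

(** A formula always contains a variable, since no connective is nullary. *)
Lemma formula_var (U : Type) (p : formula U) : U.
Proof. by elim: p. Qed.

(** A set of models of a theory is closed in the product topology. The type
    [U] itself may be assumed to be inhabited, by [formula_var]. *)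
Lemma definable_finite_extends (U : eqType) (X : set (model U)) (s : model U) :
  definable X -> (U -> forall l : seq U, extends X s [set` l]) -> X s.
Proof.
move=> [T XT] ext; rewrite XT => p Tp.
have [t + ts] := ext (formula_var p) (vars p).
rewrite XT => /(_ p Tp); rewrite (@eq_in_eval _ p t s) // => k kp.
by apply: ts; apply: mem_set.
Qed.

Theorem corollary2p7 (U : Type) (X : set (model U)) (M : Type)
    (P : M -> set (set U)) :
  definable X ->
  (forall m : M, factorization X (P m)) ->
  factorization X (common_refinement P).
Proof.
move=> defX fP; split.
  by apply: partition_common_refinement => m; case: (fP m).
apply/seteqP; split=> [s Xs _ [k _ <-]|s ext]; first by exists s.
apply: (@definable_finite_extends {classic U}) => // k0 l.
apply: finite_extends => // k.
by apply/extendsP; apply: ext; exists k.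
Qed.
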